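(* Let $c>0$, let $x_1=0$ and $x_2,\dots,x_5\in\mathbb{R}^3$ be five observation points, and let $a:[t_{\min},t_{\max}]\to\mathbb{R}^3$ be a subsonic source trajectory with emission moments $t_1<\dots<t_J$ and times of arrival $T_{jk}=t_j+c^{-1}|x_k-a(t_j)|$, as described in the context. Fix $j\in\{1,\dots,J\}$ and let $A_j\in\mathbb{R}^{4\times 4}$ be the matrix whose $(k-1)$-th row is $\big(x_k^{\top}\;\; c^2(T_{j1}-T_{jk})\big)$, $k=2,\dots,5$. If $A_j$ is invertible, then the source location $a(t_j)$ and the emission moment $t_j$ are uniquely determined by the times of arrival $T_{jk}$, $k=1,\dots,5$; that is, if $(y,s)\in\mathbb{R}^3\times\mathbb{R}$ satisfies $T_{jk}=s+c^{-1}|x_k-y|$ for all $k=1,\dots,5$, then $y=a(t_j)$ and $s=t_j$.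
   Context: Setting: $c>0$ is the constant wave speed in $\mathbb{R}^3$ and $|\cdot|$ is the Euclidean norm. A moving point source follows a continuous trajectory $a:[t_{\min},t_{\max}]\to\mathbb{R}^3$, $0<t_{\min}<t_{\max}$, with $|a'(t)|<c$ for all $t\in[t_{\min},t_{\max}]$. It emits pulses at the emission moments $t_{\min}\le t_1<\dots<t_J\le t_{\max}$. The image of the trajectory is $\Gamma=\{a(t):t\in[t_{\min},t_{\max}]\}$, and the observation points satisfy $x_k\notin\Gamma$. The time of arrival of the $j$-th pulse at $x_k$ is $T_{jk}=t_j+c^{-1}|x_k-a(t_j)|$. The observation points and $c$ are known; $a(t_j)$ and $t_j$ are unknown. The coordinate system is chosen so that $x_1=0$. *)

(* Defs.v *)
From HB Require Import structures.
From mathcomp Require Import all_boot all_order all_algebra.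
From mathcomp Require Import all_classical all_reals all_analysis.
Set Implicit Arguments.
Unset Strict Implicit.
Unset Printing Implicit Defensive.
Import Order.TTheory GRing.Theory Num.Theory.
Import numFieldNormedType.Exports.
Local Open Scope classical_set_scope.
Local Open Scope ring_scope.

(* The Euclidean norm: the norm `|v| that MathComp-Analysis puts on matrices is
   the sup norm.  The two induce the same topology, so the library's notions of
   limit and continuity are used unchanged below. *)
Definition enorm (R : realType) (n : nat) (v : 'cV[R]_n) : R :=
  Num.sqrt (\sum_(i < n) v i ord0 ^+ 2).

(* f has derivative v at t relative to D; when D is a nondegenerate segment this
   is the two-sided derivative in the interior and the one-sided derivative at
   an endpoint. *)
Definition has_derivative_within (R : realType) (n : nat) (D : set R)
    (f : R -> 'cV[R]_n.+1) (t : R) (v : 'cV[R]_n.+1) : Prop :=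
  (u - t)^-1 *: (f u - f t) @[u --> within D t^'] --> v.

(* A trajectory defined on [tmin, tmax] is a total function on R whose values
   outside the segment are irrelevant. *)
Definition subsonic_trajectory (R : realType) (c tmin tmax : R)
    (a : R -> 'cV[R]_3) : Prop :=
  {within `[tmin, tmax], continuous a} /\
  forall t, t \in `[tmin, tmax] ->
    exists2 v : 'cV[R]_3,
      has_derivative_within [set` `[tmin, tmax]] a t v & enorm v < c.

Definition emission_moments (R : realType) (tmin tmax : R) (J : nat)
    (t : 'I_J -> R) : Prop :=
  (forall j, t j \in `[tmin, tmax]) /\
  (forall i j : 'I_J, (i < j)%N -> t i < t j).

Definition arrival_time (R : realType) (c : R) (a : R -> 'cV[R]_3) (J : nat)
    (t : 'I_J -> R) (x : 'I_5 -> 'cV[R]_3) (j : 'I_J) (k : 'I_5) : R :=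
  t j + c^-1 * enorm (x k - a (t j)).

(* Indices are shifted to start at 0: the observation point x_k is x (k - 1),
   so row i (0 <= i < 4), built from x (lift ord0 i) = x (i + 1), is the row
   (x_k^T, c^2 (T_j1 - T_jk)) with k = i + 2. *)
Definition arrival_matrix (R : realType) (c : R) (x : 'I_5 -> 'cV[R]_3)
    (J : nat) (T : 'I_J -> 'I_5 -> R) (j : 'I_J) : 'M[R]_4 :=
  \matrix_(i < 4)
    (row_mx (x (lift ord0 i))^T
       (c ^+ 2 * (T j ord0 - T j (lift ord0 i)))%:M : 'rV[R]_(3 + 1)).

(* Main.v *)
Require Import Defs.
From HB Require Import structures.
From mathcomp Require Import all_boot all_order all_algebra.
From mathcomp Require Import all_classical all_reals all_analysis.
From mathcomp Require Import ring.
Set Implicit Arguments.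
Unset Strict Implicit.
Unset Printing Implicit Defensive.
Import Order.TTheory GRing.Theory Num.Theory.
Import numFieldNormedType.Exports.
Local Open Scope classical_set_scope.
Local Open Scope ring_scope.

(** Squaring the range equation [|x_k - y| = c (T_k - s)] gives
    [|x_k|^2 - 2 <x_k, y> + |y|^2 = c^2 (T_k - s)^2], which is quadratic in the
    unknowns [(y, s)].  Its quadratic part [|y|^2 - c^2 s^2] is however the same
    for every sensor, so subtracting the equation of the sensor placed at the
    origin leaves equations that are linear in [(y, s)]
    ([linearized_range_equation]).  Their coefficients form the arrival matrix,
    and their right-hand sides involve only the sensors, [c] and the arrival
    times.  The true source and any other source with the same arrival times
    therefore solve one and the same linear system ([arrival_matrix_source]),
    whose solution is unique when the arrival matrix is invertible. *)

Lemma sqr_enorm (R : realType) (n : nat) (v : 'cV[R]_n) :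
  enorm v ^+ 2 = \sum_(i < n) v i ord0 ^+ 2.
Proof. by rewrite sqr_sqrtr // sumr_ge0 // => i _; rewrite sqr_ge0. Qed.

Lemma sqr_enormB (R : realType) (n : nat) (u v : 'cV[R]_n) :
  enorm (u - v) ^+ 2 =
  enorm u ^+ 2 - 2 * (u^T *m v) ord0 ord0 + enorm v ^+ 2.
Proof.
rewrite !sqr_enorm mxE mulr_sumr -sumrB -big_split /=.
by apply: eq_bigr => i _; rewrite !mxE; ring.
Qed.

(** The difference of the squared range equations of the sensors at [x] and at
    the origin, in which [|y|^2] and [c^2 s^2] cancel. *)
Lemma linearized_range_equation (R : realType) (n : nat) (c s T0 T : R)
    (x y : 'cV[R]_n) :
  c != 0 ->
  T0 = s + c^-1 * enorm (0 - y) -> T = s + c^-1 * enorm (x - y) ->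
  (x^T *m y) ord0 ord0 + c ^+ 2 * (T0 - T) * s =
  2^-1 * (enorm x ^+ 2 - c ^+ 2 * (T ^+ 2 - T0 ^+ 2)).
Proof.
move=> c0 eT0 eT.
have range d u : u = s + c^-1 * d -> d = c * (u - s).
  by move=> ->; rewrite addrC addKr mulVKf.
have := sqr_enormB x y; rewrite (range _ _ eT) => eqx.
have := sqr_enormB 0 y; rewrite (range _ _ eT0) trmx0 mul0mx mxE => eq0.
have enorm0 : enorm (0 : 'cV[R]_n) ^+ 2 = 0.
  by rewrite sqr_enorm big1 // => i _; rewrite mxE expr0n.
rewrite enorm0 mulr0 subr0 add0r in eq0.
have -> : enorm x ^+ 2 = (c * (T - s)) ^+ 2
    + 2 * (x^T *m y) ord0 ord0 - (c * (T0 - s)) ^+ 2.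
  by rewrite eqx eq0; ring.
by field.
Qed.

(** The right-hand side depends on the source only through its arrival times;
    this is what makes two sources with equal arrival times comparable. *)
Lemma arrival_matrix_source (R : realType) (c : R) (x : 'I_5 -> 'cV[R]_3)
    (J : nat) (T : 'I_J -> 'I_5 -> R) (j : 'I_J) (y : 'cV[R]_3) (s : R) :
  c != 0 -> x ord0 = 0 ->
  (forall k, T j k = s + c^-1 * enorm (x k - y)) ->
  arrival_matrix c x T j *m (col_mx y s%:M : 'cV[R]_(3 + 1)) =
  \col_(i < 4) (2^-1 * (enorm (x (lift ord0 i)) ^+ 2
                 - c ^+ 2 * (T j (lift ord0 i) ^+ 2 - T j ord0 ^+ 2))).
Proof.
move=> c0 x0 eT; apply/row_matrixP => i.
rewrite row_mul rowK (@mul_row_col _ 1 3 1 1) -scalar_mxM.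
apply/matrixP => p q; rewrite !ord1 !mxE eqxx mulr1n.
have eT0 : T j ord0 = s + c^-1 * enorm (0 - y) by rewrite eT x0.
by rewrite -(linearized_range_equation c0 eT0 (eT (lift ord0 i))) mxE.
Qed.

Theorem theorem2p2 (R : realType) (c tmin tmax : R)
    (hc : 0 < c) (htmin : 0 < tmin) (htmax : tmin < tmax)
    (a : R -> 'cV[R]_3) (ha : subsonic_trajectory c tmin tmax a)
    (J : nat) (t : 'I_J -> R) (ht : emission_moments tmin tmax t)
    (x : 'I_5 -> 'cV[R]_3) (hx0 : x ord0 = 0)
    (hx : forall k : 'I_5, ~ (a @` `[tmin, tmax]) (x k))
    (j : 'I_J)
    (hA : arrival_matrix c x (arrival_time c a t x) j \in unitmx) :
  forall (y : 'cV[R]_3) (s : R),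
    (forall k : 'I_5,
       arrival_time c a t x j k = s + c^-1 * enorm (x k - y)) ->
    y = a (t j) /\ s = t j.
Proof.
move=> y s eT.
have c0 : c != 0 by rewrite gt_eqF.
have eqA := arrival_matrix_source c0 hx0 eT.
rewrite -(@arrival_matrix_source _ c x J (arrival_time c a t x) j (a (t j))
  (t j) c0 hx0 (fun=> erefl)) in eqA.
have /(@eq_col_mx _ 3 1 1)[-> /matrixP/(_ ord0 ord0)] :=
  can_inj (mulKmx hA) eqA.
by rewrite !mxE eqxx !mulr1n.
Qed.
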